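(* Suppose that the sets $\sigma(\mathcal{A})$ and $\sigma(\mathcal{B})$ are reciprocal free. Then the linear matrix equation $X=Af(X)B+C$ is uniquely solvable. Moreover, its unique solution is $$X=\frac{1}{n}\left(\sum_{i=0}^{n-1}\Big(\prod_{j=1}^i f^{(j-1)}(A)\Big)\left[f^{(i)}(\mathcal{X})+(n-i-1)f^{(i)}(C)\right]\Big(\prod_{j=1}^i f^{(i-j)}(B)\Big)\right),$$ where $\mathcal{X}=\mathrm{vec}^{-1}\big((I_{m^2}-\mathcal{B}^\top\otimes\mathcal{A})^{-1}\mathrm{vec}(\mathcal{C})\big)$ is the unique solution of the Stein matrix equation $\mathcal{X}=\mathcal{A}\mathcal{X}\mathcal{B}+\mathcal{C}$.
   Context: Let $m,n\ge 1$ be integers, $A,B,C\in\mathbb{C}^{m\times m}$, and let $f:\mathbb{C}^{m\times m}\to\mathbb{C}^{m\times m}$ satisfy (1) (''linear'' in the paper's sense) $f(PQ+RS)=f(P)f(Q)+f(R)f(S)$ for all $P,Q,R,S\in\mathbb{C}^{m\times m}$; (2) (period-$n$) $n$ is the least positive integer such that $f^{(n)}(P)=P$ for all $P\in\mathbb{C}^{m\times m}$. Here $f^{(i)}$ is the $i$-fold composition of $f$ with itself, and $f^{(0)}$ is the identity map. All matrix products $\prod_{j=1}^i$ are ordered from left to right in increasing $j$, and empty products are the identity matrix. For $i\ge 1$ and $X\in\mathbb{C}^{m\times m}$ set $G_i(X)=\Big(\prod_{j=1}^i f^{(j-1)}(A)\Big) f^{(i)}(X)\Big(\prod_{j=1}^i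 f^{(i-j)}(B)\Big)$, i.e. $G_i(X)=A f(A)\cdots f^{(i-1)}(A)\, f^{(i)}(X)\, f^{(i-1)}(B)\cdots f(B)B$; and $G_0(X)=X$. Set $\mathcal{A}=\prod_{i=1}^n f^{(i-1)}(A)=A f(A)\cdots f^{(n-1)}(A)$, $\mathcal{B}=\prod_{i=1}^n f^{(n-i)}(B)=f^{(n-1)}(B)\cdots f(B)B$, and $\mathcal{C}=\sum_{i=1}^{n}G_{i-1}(C)$. $\sigma(M)$ is the set of eigenvalues of $M$; $\otimes$ is the Kronecker product; $\mathrm{vec}(M)$ stacks the columns of $M$ into one column vector, and $\mathrm{vec}^{-1}$ is its inverse. Two sets $S_1,S_2$ of complex numbers are called reciprocal free if $1/\lambda\notin S_1$ whenever $\lambda\in S_2$, where $0$ and $\infty$ are regarded as reciprocals of each other. *)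

(* Defs.v *)
From mathcomp Require Import all_boot all_order all_algebra.
From mathcomp Require Import reals.
From mathcomp.real_closed Require Import complex mxtens.

Set Implicit Arguments.
Unset Strict Implicit.
Unset Printing Implicit Defensive.

Import Order.TTheory GRing.Theory Num.Theory.
Local Open Scope ring_scope.

(* The convention that 0 and oo are reciprocals of each other imposes nothing
   on sets of (finite) numbers: 1/0 = oo belongs to neither set.  The guard
   l != 0 is needed because 0^-1 = 0 in MathComp. *)
Definition reciprocal_free (F : fieldType) (S1 S2 : pred F) : Prop :=
  forall l : F, l \in S2 -> l != 0 -> l^-1 \notin S1.

(* MathComp's eigenvalue is defined by nonzero row eigenvectors; for square
   matrices over a field this gives the same set as column eigenvectors. *)
Definition spectrum (F : fieldType) (m : nat) (M : 'M[F]_m) : pred F :=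
  [pred l | eigenvalue M l].

(* mxtens_index (j, i) = j * p + i is the indexing used by the Kronecker
   product *t; MathComp's mxvec lists the rows instead of the columns. *)
Definition vec (F : Type) (p q : nat) (M : 'M[F]_(p, q)) : 'cV[F]_(q * p) :=
  \col_k M (mxtens_unindex k).2 (mxtens_unindex k).1.

Definition unvec (F : Type) (p q : nat) (v : 'cV[F]_(q * p)) : 'M[F]_(p, q) :=
  \matrix_(i, j) v (mxtens_index (j, i)) 0.

Lemma vecK (F : Type) (p q : nat) : cancel (@vec F p q) (@unvec F p q).
Proof. by move=> M; apply/matrixP => i j; rewrite !mxE mxtens_indexK. Qed.

Lemma unvecK (F : Type) (p q : nat) : cancel (@unvec F p q) (@vec F p q).
Proof.
move=> v; apply/matrixP => k l; rewrite !mxE (ord1 l).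
by rewrite -surjective_pairing mxtens_unindexK.
Qed.

Section SelfMap.

Variables (F : fieldType) (m : nat) (f : 'M[F]_m -> 'M[F]_m).

Definition preserves_mul_add : Prop :=
  forall P Q R S : 'M[F]_m, f (P *m Q + R *m S) = f P *m f Q + f R *m f S.

Definition has_period (n : nat) : Prop :=
  [/\ (0 < n)%N, forall P, iter n f P = P
    & forall k, (0 < k)%N -> (forall P, iter k f P = P) -> (n <= k)%N].

(* A f(A) ... f^(i-1)(A) *)
Definition lprod (A : 'M[F]_m) (i : nat) : 'M[F]_m :=
  \prod_(1 <= j < i.+1) iter (j - 1) f A.

(* f^(i-1)(B) ... f(B) B *)
Definition rprod (B : 'M[F]_m) (i : nat) : 'M[F]_m :=
  \prod_(1 <= j < i.+1) iter (i - j) f B.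

Definition G (A B : 'M[F]_m) (i : nat) (X : 'M[F]_m) : 'M[F]_m :=
  lprod A i *m iter i f X *m rprod B i.

Lemma G0 (A B X : 'M[F]_m) : G A B 0 X = X.
Proof. by rewrite /G /lprod /rprod !big_geq //= mul1mx mulmx1. Qed.

Definition Gsum (A B C : 'M[F]_m) (n : nat) : 'M[F]_m :=
  \sum_(1 <= i < n.+1) G A B (i - 1) C.

End SelfMap.

Definition stein_mx (F : fieldType) (m : nat) (A B : 'M[F]_m) : 'M[F]_(m * m) :=
  1%:M - B^T *t A.

(* Main.v *)
(* A periodic f is onto; comparing f (P I + R 0) with f P for all P, R then
   forces f 0 = 0 and f I = I, so f is a ring automorphism.  The n-th
   iterate of T X = A f(X) B + C is therefore the Stein operator
   X |-> cA X cB + cC.  A fixed point of T solves the Stein equation;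
   conversely T maps Stein solutions to Stein solutions, so the unique one is
   fixed by T.  Averaging the identities X = T^i X over 0 <= i < n gives the
   formula. *)
Require Import Defs.
From mathcomp Require Import all_boot all_order all_algebra.
From mathcomp Require Import reals.
From mathcomp.real_closed Require Import complex mxtens.
Import GRing.Theory.
Local Open Scope ring_scope.

Lemma eigenvalue_trmx (F : fieldType) (m : nat) (M : 'M[F]_m) (a : F) :
  eigenvalue M^T a = eigenvalue M a.
Proof.
rewrite /eigenvalue /eigenspace !kermx_eq0 !row_free_unit.
by rewrite -[in RHS]unitmx_tr linearB /= tr_scalar_mx.
Qed.

(* X = Q K is a rank factorization.  The equation makes the row space of X
   stable under B, say K B = D K, and then A Q D = Q: the eigenvalues of D are
   eigenvalues of B, and their inverses are eigenvalues of A. *)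
Lemma stein_homogeneous_eq0 (F : numClosedFieldType) (p q : nat)
    (A : 'M[F]_p) (B : 'M[F]_q) (X : 'M[F]_(p, q)) :
  reciprocal_free (spectrum A) (spectrum B) ->
  X = A *m X *m B -> X = 0.
Proof.
move=> rf eqX; apply/eqP; rewrite -mxrank_eq0 -leqn0 leqNgt; apply/negP => r_gt0.
have sXXB : (X <= X *m B)%MS by rewrite {1}eqX -mulmxA submxMl.
(* Multiplication by [B] cannot raise the rank, so the inclusion [sXXB] is an equality of row
   spaces. *)
have sXBX : (X *m B <= X)%MS.
  by rewrite -(geq_leqif (mxrank_leqif_sup sXXB)) mxrankM_maxl.
move: (col_base_full X) (row_base_free X) (eq_row_base X) (mulmx_base X).
move: (col_base X) (row_base X) => Q K Qfull Kfree eqKX QK.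
have /submxP[D KB] : (K *m B <= K)%MS.
  by rewrite (eqmxMr B eqKX) eqKX.
have AQD : A *m Q *m D = Q.
  apply: (row_free_inj Kfree).
  by rewrite /= -!mulmxA -KB (mulmxA Q) QK mulmxA -eqX.
(* [D] is square of size [\rank X], which is positive, so it has an eigenvalue. *)
have [l Dl] := eigenvalue_closed D r_gt0.
have /eigenvalueP[z zD z0] := Dl.
have Bl : eigenvalue B l.
  apply/eigenvalueP; exists (z *m K).
    by rewrite -mulmxA KB mulmxA zD scalemxAl.
  by rewrite -(inj_eq (row_free_inj Kfree)) mul0mx in z0.
(* A left eigenvector of [D] passes to [B] through [K]; passing to [A] through [Q] takes a right
   one. *)
have : eigenvalue D^T l by rewrite eigenvalue_trmx.
case/eigenvalueP => w wD w0.
have Dw : D *m w^T = l *: w^T by rewrite -[D]trmxK -trmx_mul wD linearZ.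
have Qw0 : Q *m w^T != 0.
  apply: contraNneq w0 => Qw0; rewrite -trmx_eq0; apply/eqP.
  by apply: (row_full_inj Qfull); rewrite mulmx0.
have lAQw : l *: (A *m (Q *m w^T)) = Q *m w^T.
  by rewrite -{2}AQD -!mulmxA Dw !linearZ.
have l0 : l != 0.
  by apply: contraNneq Qw0 => l0; rewrite -lAQw l0 scale0r.
have /negP[] := rf l Bl l0; rewrite inE -eigenvalue_trmx.
apply/eigenvalueP; exists (Q *m w^T)^T; last by rewrite trmx_eq0.
by rewrite -trmx_mul -[in RHS]lAQw linearZ scalerA mulVf // scale1r.
Qed.

Lemma vec_mulmx (F : comPzRingType) (p q r s : nat)
    (A : 'M[F]_(p, q)) (X : 'M[F]_(q, r)) (B : 'M[F]_(r, s)) :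
  vec (A *m X *m B) = (B^T *t A) *m vec X.
Proof.
apply/colP => k; rewrite !mxE (reindex (@mxtens_index r q)) /=; last first.
  by exists (@mxtens_unindex r q) => i _; rewrite (mxtens_indexK, mxtens_unindexK).
under eq_bigr => j _ do rewrite !mxE mulr_suml.
rewrite pair_bigA; apply: eq_bigr => -[j i] _ /=.
by rewrite !mxE !mxtens_indexK /= mulrC mulrA.
Qed.

Lemma stein_mx_vec (F : fieldType) (m : nat) (A B X : 'M[F]_m) :
  stein_mx A B *m vec X = vec (X - A *m X *m B).
Proof.
rewrite mulmxBl mul1mx -vec_mulmx.
by apply/colP => k; rewrite !mxE.
Qed.

(** Under [vec], the kernel of [stein_mx A B] is the set of solutions of [X = A *m X *m B], which is
    trivial. The transpose appears because [inj_row_free] speaks of row vectors. *)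
Lemma stein_mx_unit (F : numClosedFieldType) (m : nat) (A B : 'M[F]_m) :
  reciprocal_free (spectrum A) (spectrum B) ->
  stein_mx A B \in unitmx.
Proof.
move=> rf; rewrite -unitmx_tr -row_free_unit; apply: inj_row_free => v.
move/(congr1 trmx); rewrite trmx_mul trmxK trmx0 -(unvecK v^T) stein_mx_vec.
move=> v0; apply/eqP; rewrite -trmx_eq0 -(unvecK v^T); apply/eqP.
have /eqP := congr1 (@unvec F m m) v0; rewrite vecK.
have -> : @unvec F m m 0 = 0 by apply/matrixP => i j; rewrite !mxE.
rewrite subr_eq0 => /eqP /(stein_homogeneous_eq0 _ _ _ _ _ _ rf) ->.
by apply/colP => k; rewrite !mxE.
Qed.

Lemma stein_mx_solve (F : fieldType) (m : nat) (A B C X : 'M[F]_m) :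
  stein_mx A B \in unitmx ->
  X = A *m X *m B + C <->
  X = unvec (invmx (stein_mx A B) *m vec C).
Proof.
move=> Su; split=> [eqX | ->].
  rewrite -[LHS](@vecK F m m); congr (unvec _).
  by rewrite -[vec X](mulKmx Su) stein_mx_vec {1}eqX addrC addKr.
set Y := unvec _; apply/eqP; rewrite addrC -subr_eq; apply/eqP.
by apply: (can_inj (@vecK F m m)); rewrite -stein_mx_vec unvecK mulKVmx.
Qed.

Lemma onto_preserves_mul_add (F : fieldType) (m : nat) (f : 'M[F]_m -> 'M[F]_m) :
  preserves_mul_add f -> (forall P, exists P', f P' = P) ->
  [/\ f 0 = 0, f 1%:M = 1%:M, {morph f : P Q / P + Q}
    & {morph f : P Q / P *m Q}].
Proof.
move=> fP f_onto.
(* With [P = f P'] and [R = f R'], the left side is [f (P' *m 1 + R' *m 0) = f P']. *)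
have key (P R : 'M_m) : P *m f 1%:M + R *m f 0 = P.
  have [[P' <-] [R' <-]] := (f_onto P, f_onto R).
  by rewrite -fP mulmx1 mulmx0 addr0.
have f1 : f 1%:M = 1%:M by have := key 1%:M 0; rewrite mul1mx mul0mx addr0.
have f0 : f 0 = 0 by have := key 0 1%:M; rewrite mul1mx mul0mx add0r.
split=> // P Q; first by rewrite -[P in LHS]mulmx1 -[Q in LHS]mulmx1 fP f1 !mulmx1.
by have := fP P Q 0 0; rewrite f0 !mul0mx !addr0.
Qed.

Lemma has_period_onto (F : fieldType) (m n : nat) (f : 'M[F]_m -> 'M[F]_m) :
  has_period f n -> forall P, exists P', f P' = P.
Proof. by case; case: n => // n _ fn _ P; exists (iter n f P); rewrite -iterS. Qed.

Lemma lprod0 (F : fieldType) (m : nat) (f : 'M[F]_m -> 'M[F]_m) A :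
  lprod f A 0 = 1%:M.
Proof. by rewrite /lprod big_geq. Qed.

Lemma lprodS (F : fieldType) (m : nat) (f : 'M[F]_m -> 'M[F]_m) A i :
  f 1%:M = 1%:M -> {morph f : P Q / P *m Q} ->
  lprod f A i.+1 = A *m f (lprod f A i).
Proof.
move=> f1 fM; rewrite /lprod big_nat_recl //=.
rewrite (big_morph f fM f1) mulmxE; congr (_ * _).
rewrite !big_nat; apply: eq_bigr => -[|j] //= _.
by rewrite !subn1.
Qed.

Lemma rprod0 (F : fieldType) (m : nat) (f : 'M[F]_m -> 'M[F]_m) B :
  rprod f B 0 = 1%:M.
Proof. by rewrite /rprod big_geq. Qed.

Lemma rprodS (F : fieldType) (m : nat) (f : 'M[F]_m -> 'M[F]_m) B i :
  f 1%:M = 1%:M -> {morph f : P Q / P *m Q} ->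
  rprod f B i.+1 = f (rprod f B i) *m B.
Proof.
move=> f1 fM; rewrite /rprod big_nat_recr //= subnn /=.
rewrite (big_morph f fM f1) mulmxE; congr (_ * _).
rewrite !big_nat; apply: eq_bigr => j /andP[_].
by rewrite ltnS => /subSn ->.
Qed.

(** Multiplicativity of [f] lets the outermost factors [A] and [B] split off; hence [G f A B i] is
    the i-th iterate of [X |-> A f(X) B]. *)
Lemma GS (F : fieldType) (m : nat) (f : 'M[F]_m -> 'M[F]_m) A B i X :
  f 1%:M = 1%:M -> {morph f : P Q / P *m Q} ->
  G f A B i.+1 X = A *m f (G f A B i X) *m B.
Proof. by move=> f1 fM; rewrite /G lprodS // rprodS // !fM iterS !mulmxA. Qed.

(** By induction: one more application shifts every index of [G] by one, and the added [C] supplies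
    the new term [j = 0]. *)
Lemma iter_affine (F : fieldType) (m : nat) (f : 'M[F]_m -> 'M[F]_m) A B C i X :
  [/\ f 0 = 0, f 1%:M = 1%:M, {morph f : P Q / P + Q}
    & {morph f : P Q / P *m Q}] ->
  iter i (fun Y => A *m f Y *m B + C) X =
  G f A B i X + \sum_(0 <= j < i) G f A B j C.
Proof.
case=> f0 f1 fD fM; elim: i => [|i IH]; first by rewrite big_geq // G0 addr0.
rewrite iterS IH fD mulmxDr mulmxDl -GS // -addrA; congr (_ + _).
rewrite big_nat_recl // G0 addrC; congr (_ + _).
rewrite (big_morph f fD f0) mulmx_sumr mulmx_suml.
by apply: eq_bigr => j _; rewrite -GS.
Qed.

Lemma GsumE (F : fieldType) (m : nat) (f : 'M[F]_m -> 'M[F]_m) A B C n :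
  Gsum f A B C n = \sum_(0 <= j < n) G f A B j C.
Proof.
rewrite /Gsum big_add1 /=.
by apply: eq_bigr => j _; rewrite subn1.
Qed.

(** The term [g j] occurs in the inner sums for [j < i < n], hence [n - j - 1] times; this is the
    source of the weights in the formula. *)
Lemma sum_partial_sums (V : zmodType) (n : nat) (g : nat -> V) :
  \sum_(0 <= i < n) \sum_(0 <= j < i) g j =
  \sum_(0 <= i < n) g i *+ (n - i - 1).
Proof.
elim: n => [|n IH]; first by rewrite !big_geq.
rewrite !big_nat_recr //= subSnn subnn addr0 IH -big_split /=.
rewrite !big_nat; apply: eq_bigr => i /andP[_ ltin].
by rewrite -mulrSr !subn1 prednK ?subn_gt0 // subSn // ltnW.
Qed.

Theorem theorem3p2 (R : realType) (m n : nat) (A B C : 'M[R[i]]_m)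
    (f : 'M[R[i]]_m -> 'M[R[i]]_m) :
  (1 <= m)%N -> (1 <= n)%N ->
  preserves_mul_add f -> has_period f n ->
  let cA := lprod f A n in
  let cB := rprod f B n in
  let cC := Gsum f A B C n in
  reciprocal_free (spectrum cA) (spectrum cB) ->
  let cX := unvec (invmx (stein_mx cA cB) *m vec cC) in
  [/\ exists! X, X = A *m f X *m B + C,
      forall X, X = A *m f X *m B + C ->
        X = n%:R^-1 *:
          \sum_(0 <= i < n)
            lprod f A i *m (iter i f cX + (n - i - 1)%:R *: iter i f C)
              *m rprod f B i,
      stein_mx cA cB \in unitmx,
      cX = cA *m cX *m cB + cC
    & forall Y, Y = cA *m Y *m cB + cC -> Y = cX].
Proof.
move=> _ n_gt0 fP per cA cB cC rf cX.
have f_rmorph := onto_preserves_mul_add _ _ _ fP (has_period_onto _ _ _ _ per).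
have Su : stein_mx cA cB \in unitmx by exact: stein_mx_unit.
have solve Y := stein_mx_solve _ _ cA cB cC Y Su; rewrite -/cX in solve.
pose T X := A *m f X *m B + C.
have iterT i X : iter i T X = _ := iter_affine _ _ f A B C i X f_rmorph.
have Tn X : iter n T X = cA *m X *m cB + cC.
  by rewrite iterT -GsumE /G; case: per => _ ->.
have uniqT X : X = T X -> X = cX.
  by move=> TX; apply/solve; rewrite -Tn iter_fix.
have TcX : cX = T cX.
  (* Read through [solve], the trivial equality is the Stein equation for [cX]. As [T] commutes with
     [iter n T], the matrix [T cX] satisfies it too. *)
  have /solve cXE : cX = cX by [].
  by apply/esym/solve; rewrite -Tn -iterSr iterS Tn -cXE.
split=> //; first by exists cX; split=> // X /uniqT.
- move=> X /uniqT ->.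
  have nz : n%:R != 0 :> R[i] by rewrite Num.Theory.pnatr_eq0 -lt0n.
  apply: (scalerI nz); rewrite scalerA mulfV // scale1r scaler_nat.
  (* Each of the [n] copies of [cX] is replaced by [iter i T cX] for a different [i]. *)
  transitivity (\sum_(0 <= i < n) iter i T cX).
    rewrite -[n in LHS]subn0 -sumr_const_nat.
    by apply: eq_bigr => i _; rewrite iter_fix.
  under eq_bigr do rewrite iterT.
  rewrite big_split /= sum_partial_sums -big_split /=.
  apply: eq_bigr => i _.
  by rewrite /G mulmxDr mulmxDl scaler_nat -scaler_nat -scalemxAr -scalemxAl scaler_nat.
- exact/solve.
- by move=> Y /solve.
Qed.
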